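(* Let $R$ be a commutative ring, $P_0=R^2$ with standard basis $e_1=(1,0)$, $e_2=(0,1)$, and let $\theta_0:R\xrightarrow{\cong}\det(R^2)$ be the isomorphism $1\mapsto e_1\wedge e_2$. Then the generalized Vaserstein symbol $V_{-\theta_0}$ associated to the trivialization $-\theta_0$ coincides with the usual Vaserstein symbol via the identification $\tilde V(R)\cong W_E(R)$: for every unimodular row $a=(a_1,a_2,a_3)$ of length $3$ and all $b_1,b_2,b_3\in R$ with $\sum_{i=1}^3a_ib_i=1$, $$V_{-\theta_0}(a)=[R^4,\psi_4,V(a,b)]\ \text{ in } V(R),\qquad V(a,b)=\begin{pmatrix} 0 & -a_1 & -a_2 & -a_3 \\ {a_1} & 0 & -b_3 & b_2 \\ {a_2} & b_3 & 0 & -b_1 \\ {a_3} & -b_2 & b_1 & 0 \end{pmatrix}.$$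
   Context: Unimodular rows of length $3$ are identified with surjective $R$-linear maps $a:R^3=P_0\oplus R\to R$, $x\mapsto\sum a_ix_i$. Forms: an alternating isomorphism on a finitely generated projective module $P$ is an isomorphism $f: P\to P^\vee$ with $f(p)(p)=0$ for all $p$; it is the same as a non-degenerate alternating form $\chi$ on $P$ via $f(q)=\chi(-,q)$; a matrix $M$ corresponds to the form $(x,y)\mapsto x^tMy$. For a linear map $\alpha$, $\alpha^t\chi\alpha$ denotes $(x,y)\mapsto\chi(\alpha x,\alpha y)$; $\perp$ is the orthogonal sum. $\psi_2=\begin{pmatrix} 0 & 1 \\ -1 & 0 \end{pmatrix}$, $\psi_{2n+2}=\psi_{2n}\perp\psi_2$. The group $V(R)$: triples $(P,g,f)$ with $P$ finitely generated projective and $f,g$ alternating isomorphisms on $P$; $(P,f_0,f_1)$, $(P',f_0',f_1')$ are isometric if there is an isomorphism $h:P\to P'$ with $f_i=h^\vee f_i' h$ for $i=0,1$. $V(R)$ is the quotient of the free abelian group on isometry classes $[P,g,f]$ by the relations $[P\oplus P',g\perp g',f\perp f']=[P,g,f]+[P',g',f']$ and $[P,f_0,f_1]+[P,f_1,f_2]=[P,f_0,f_2]$. Usual Vaserstein symbol: $W'_E(R)$ is the abelian group (under $\perp$) of alternating invertible matrices of even size modulo the relation $M\sim N$ (for $M$ of size $2m$, $N$ of size $2n$) iff $M\perp\psi_{2n+2s}=E^t(N\perp\psi_{2m+2s})E$ for some $s$ and some $E\in E_{2m+2n+2s}(R)$ (product of elementary matrices); $W_E(R)$ is the kernel of the Pfaffian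 $W'_E(R)\to R^\times$. The usual Vaserstein symbol sends $a$ to the class of $V(a,b)$ in $W_E(R)$ (independent of $b$). The identification $W'_E(R)\cong V(R)$ sends the class of a $2m\times2m$ matrix $M$ to $[R^{2m},\psi_{2m},M]$; it maps $W_E(R)$ onto the subgroup $\tilde V(R)$. Generalized Vaserstein symbol associated to a trivialization $\vartheta:R\xrightarrow{\cong}\det(P_0)$: $\chi_0$ is the form $(p,q)\mapsto\vartheta^{-1}(p\wedge q)$ on $P_0$. For a surjection $a:P_0\oplus R\to R$ with section $s$, let $P(a)=\ker a$, $i:P_0\oplus R\to P(a)\oplus R$, $i(p)=(p-s(a(p)),a(p))$, and $\chi_a(p,q)=\theta^{-1}(p\wedge q)$ on $P(a)$, where $\theta$ is $\vartheta$ followed by $\det(P_0)\cong\det(P_0\oplus R)\cong\det(P(a))$ (the first map is $w\mapsto w\wedge e$ with $e$ the generator $1$ of the summand $R$, the second the inverse of $w\mapsto w\wedge s(1)$). Then $V_\vartheta(a)=[P_0\oplus R^2,\chi_0\perp\psi_2,(i\oplus1)^t(\chi_a\perp\psi_2)(i\oplus1)]$, independent of $s$. *)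

(* Defs.v *)
From HB Require Import structures.
From mathcomp Require Import all_boot all_order all_algebra.
From mathcomp Require Import all_classical.
Set Implicit Arguments.
Unset Strict Implicit.
Unset Printing Implicit Defensive.
Import GRing.Theory.
Local Open Scope ring_scope.
Local Open Scope quotient_scope.

(* Commutative rings are [comPzRingType]s, so the zero ring is allowed.       *)

(** * Exterior powers of modules *)

Section ExteriorPower.
Variables (R : comPzRingType) (M : lmodType R) (n : nat).
Implicit Types (t : {ffun 'I_n -> M}).

Definition upd t (i : 'I_n) (x : M) : {ffun 'I_n -> M} :=
  [ffun k => if k == i then x else t k].

Record alternating_multilinear (L : lmodType R) (phi : {ffun 'I_n -> M} -> L) :
  Prop := AlternatingMultilinear {
  altml_linear : forall t i (c : R) x y,
    phi (upd t i (c *: x + y)) = c *: phi (upd t i x) + phi (upd t i y);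
  altml_alt : forall t i j, i != j -> t i = t j -> phi t = 0 }.

(* A word [:: (c_1, t_1); ...; (c_k, t_k)] stands for the formal sum          *)
(* c_1 (t_1 0 /\ ... /\ t_1 n.-1) + ... + c_k (t_k 0 /\ ... /\ t_k n.-1);     *)
(* [ext_eq] is the congruence generated by the relations of the free module   *)
(* on M^n together with multilinearity and alternation.                       *)
Local Notation ext_word := (seq (R * {ffun 'I_n -> M})).

Inductive ext_eq : ext_word -> ext_word -> Prop :=
| ext_refl u : ext_eq u u
| ext_sym u v : ext_eq u v -> ext_eq v u
| ext_trans u v w : ext_eq u v -> ext_eq v w -> ext_eq u w
| ext_cat u u' v v' : ext_eq u u' -> ext_eq v v' -> ext_eq (u ++ v) (u' ++ v')
| ext_catC u v : ext_eq (u ++ v) (v ++ u)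
| ext_zero t : ext_eq [:: (0, t)] [::]
| ext_coefD c d t : ext_eq [:: (c + d, t)] [:: (c, t); (d, t)]
| ext_linear c t i d x y :
    ext_eq [:: (c, upd t i (d *: x + y))]
           [:: (c * d, upd t i x); (c, upd t i y)]
| ext_alt c t i j : i != j -> t i = t j -> ext_eq [:: (c, t)] [::].

Definition ext_eqb (u v : ext_word) : bool := `[< ext_eq u v >].

Lemma ext_eqb_refl : reflexive ext_eqb.
Proof. by move=> u; apply/asboolP; apply: ext_refl. Qed.

Lemma ext_eqb_sym : symmetric ext_eqb.
Proof.
by move=> u v; apply/idP/idP => /asboolP h; apply/asboolP; apply: ext_sym.
Qed.

Lemma ext_eqb_trans : transitive ext_eqb.
Proof.
move=> v u w /asboolP uv /asboolP vw; apply/asboolP; exact: ext_trans uv vw.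
Qed.

Canonical ext_equiv := EquivRel ext_eqb ext_eqb_refl ext_eqb_sym ext_eqb_trans.

Definition extpow : Type := {eq_quot ext_equiv}.
HB.instance Definition _ := Choice.on extpow.
HB.instance Definition _ := EqQuotient.on extpow.

Local Notation cl := (\pi_extpow : ext_word -> extpow).

Lemma ext_clP u v : cl u = cl v <-> ext_eq u v.
Proof. by split=> [/eqmodP/asboolP | h] //; apply/eqmodP/asboolP. Qed.

Lemma ext_reprP u : ext_eq (repr (cl u)) u.
Proof. by apply/ext_clP; rewrite reprK. Qed.

Definition ext_scale_word (c : R) (u : ext_word) : ext_word :=
  [seq (c * x.1, x.2) | x <- u].

Lemma ext_scale_word_eq c u v :
  ext_eq u v -> ext_eq (ext_scale_word c u) (ext_scale_word c v).
Proof.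
elim=> {u v}; rewrite /ext_scale_word /=.
- by move=> u; apply: ext_refl.
- by move=> u v _; apply: ext_sym.
- by move=> u v w _ h _; apply: ext_trans.
- by move=> u u' v v' _ h _ h'; rewrite !map_cat; apply: ext_cat.
- by move=> u v; rewrite !map_cat; apply: ext_catC.
- by move=> t; rewrite mulr0; apply: ext_zero.
- by move=> c' d t; rewrite mulrDr; apply: ext_coefD.
- by move=> c' t i d x y; rewrite mulrA; apply: ext_linear.
- by move=> c' t i j ij tij; apply: ext_alt tij.
Qed.

Definition ext_add (x y : extpow) : extpow := cl (repr x ++ repr y).
Definition ext_scale (c : R) (x : extpow) : extpow :=
  cl (ext_scale_word c (repr x)).

Lemma ext_addE u v : ext_add (cl u) (cl v) = cl (u ++ v).
Proof. by apply/ext_clP; apply: ext_cat; apply: ext_reprP. Qed.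

Lemma ext_scaleE c u : ext_scale c (cl u) = cl (ext_scale_word c u).
Proof. by apply/ext_clP; apply: ext_scale_word_eq; apply: ext_reprP. Qed.

Lemma ext_ind (P : extpow -> Prop) : (forall u, P (cl u)) -> forall x, P x.
Proof. by move=> h x; rewrite -[x]reprK. Qed.

Lemma ext_addA : associative ext_add.
Proof.
by elim/ext_ind=> u; elim/ext_ind=> v; elim/ext_ind=> w; rewrite !ext_addE catA.
Qed.

Lemma ext_addC : commutative ext_add.
Proof.
elim/ext_ind=> u; elim/ext_ind=> v; rewrite !ext_addE.
by apply/ext_clP; apply: ext_catC.
Qed.

Lemma ext_add0 : left_id (cl [::]) ext_add.
Proof. by elim/ext_ind=> u; rewrite ext_addE. Qed.

Lemma ext_scale_wordDl c d u :
  ext_eq (ext_scale_word (c + d) u) (ext_scale_word c u ++ ext_scale_word d u).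
Proof.
elim: u => [|[e t] u ih] /=; first exact: ext_refl.
rewrite mulrDl.
apply: ext_trans
  (_ : ext_eq _ ([:: (c * e, t); (d * e, t)] ++
                 (ext_scale_word c u ++ ext_scale_word d u))) _.
  exact: (ext_cat (ext_coefD _ _ _) ih).
apply: (@ext_cat [:: (c * e, t)] [:: (c * e, t)]); first exact: ext_refl.
have -> : forall p v, ext_scale_word c u ++ p :: v = (ext_scale_word c u ++ [:: p]) ++ v.
  by move=> p v; rewrite -catA.
rewrite -[X in ext_eq X _]/(([:: (d * e, t)] ++ ext_scale_word c u) ++ _).
by apply: ext_cat (ext_refl _); apply: ext_catC.
Qed.

Lemma ext_scale_word0 u : ext_eq (ext_scale_word 0 u) [::].
Proof.
elim: u => [|[e t] u ih] /=; first exact: ext_refl.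
by rewrite mul0r; apply: (ext_cat (ext_zero t) ih).
Qed.

Lemma ext_scale_word1 u : ext_scale_word 1 u = u.
Proof. by elim: u => [|[e t] u ih] //=; rewrite ih mul1r. Qed.

Lemma ext_addN : left_inverse (cl [::]) (ext_scale (-1)) ext_add.
Proof.
elim/ext_ind=> u; rewrite ext_scaleE ext_addE; apply/ext_clP.
rewrite -{2}[u]ext_scale_word1.
apply: ext_trans (ext_sym (ext_scale_wordDl _ _ _)) _.
by rewrite addNr; apply: ext_scale_word0.
Qed.

HB.instance Definition _ :=
  GRing.isZmodule.Build extpow ext_addA ext_addC ext_add0 ext_addN.

Lemma ext_scaleA c d x : ext_scale c (ext_scale d x) = ext_scale (c * d) x.
Proof.
elim/ext_ind: x => u; rewrite !ext_scaleE; congr (cl _).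
by rewrite /ext_scale_word -map_comp; apply: eq_map => -[e t] /=; rewrite mulrA.
Qed.

Lemma ext_scale1 : left_id 1 ext_scale.
Proof. by elim/ext_ind=> u; rewrite ext_scaleE ext_scale_word1. Qed.

Lemma ext_scaleDr : right_distributive ext_scale +%R.
Proof.
move=> c; elim/ext_ind=> u; elim/ext_ind=> v.
by rewrite /GRing.add /= ext_addE !ext_scaleE ext_addE /ext_scale_word map_cat.
Qed.

Lemma ext_scaleDl x : {morph ext_scale^~ x : c d / c + d}.
Proof.
elim/ext_ind: x => u c d; rewrite !ext_scaleE [RHS]ext_addE.
by apply/ext_clP; apply: ext_scale_wordDl.
Qed.

HB.instance Definition _ := GRing.Zmodule_isLmodule.Build R extpow
  ext_scaleA ext_scale1 ext_scaleDr ext_scaleDl.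

Lemma ext_addcl u v : cl u + cl v = cl (u ++ v).
Proof. exact: ext_addE. Qed.

Lemma ext_scalecl c u : c *: cl u = cl (ext_scale_word c u).
Proof. exact: ext_scaleE. Qed.

Definition wedge t : extpow := cl [:: (1, t)].

Lemma wedge_altml : alternating_multilinear wedge.
Proof.
split=> [t i c x y|t i j ij tij].
  rewrite /wedge ext_scalecl ext_addcl /= mulr1; apply/ext_clP.
  by apply: ext_trans (ext_linear _ _ _ _ _ _) _; rewrite mul1r; apply: ext_refl.
by apply/ext_clP; apply: ext_alt tij.
Qed.

Lemma ext_clE u : cl u = \sum_(x <- u) x.1 *: wedge x.2.
Proof.
elim: u => [|[c t] u ih]; first by rewrite big_nil.
by rewrite big_cons -ih /= /wedge ext_scalecl ext_addcl /= mulr1.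
Qed.

Lemma ext_wedge_ind (P : extpow -> Prop) :
  P 0 -> (forall c t x, P x -> P (c *: wedge t + x)) -> forall x, P x.
Proof.
move=> P0 Ps; elim/ext_ind=> u; rewrite ext_clE.
by elim: u => [|x u ih]; rewrite ?big_nil ?big_cons //; apply: Ps.
Qed.

Section Lift.
Variables (L : lmodType R) (phi : {ffun 'I_n -> M} -> L).

Definition ext_eval (u : ext_word) : L := \sum_(x <- u) x.1 *: phi x.2.

Definition ext_lift (w : extpow) : L := ext_eval (repr w).

Hypothesis phiP : alternating_multilinear phi.

Lemma ext_eval_eq u v : ext_eq u v -> ext_eval u = ext_eval v.
Proof.
elim=> {u v}; rewrite /ext_eval //.
- by move=> u v w _ -> _ ->.
- by move=> u u' v v' _ h _ h'; rewrite !big_cat /= h h'.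
- by move=> u v; rewrite !big_cat /= addrC.
- by move=> t; rewrite big_seq1 big_nil scale0r.
- by move=> c d t; rewrite !big_cons !big_nil /= !addr0 scalerDl.
- move=> c t i d x y; rewrite !big_cons !big_nil /= !addr0.
  by rewrite (altml_linear phiP) scalerDr scalerA.
- by move=> c t i j ij tij; rewrite big_seq1 big_nil (altml_alt phiP ij tij) scaler0.
Qed.

Lemma ext_lift_cl u : ext_lift (cl u) = ext_eval u.
Proof. by apply: ext_eval_eq; apply: ext_reprP. Qed.

Lemma ext_lift_wedge t : ext_lift (wedge t) = phi t.
Proof. by rewrite ext_lift_cl /ext_eval big_seq1 scale1r. Qed.

Lemma ext_lift_linear : linear ext_lift.
Proof.
move=> c; elim/ext_ind=> u; elim/ext_ind=> v.
rewrite ext_scalecl ext_addcl !ext_lift_cl.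
rewrite /ext_eval big_cat big_map scaler_sumr /=; congr (_ + _).
by apply: eq_bigr => x _; rewrite scalerA.
Qed.

End Lift.
End ExteriorPower.

Definition wedge2 (R : comPzRingType) (M : lmodType R) (p q : M) : extpow M 2 :=
  wedge [ffun k => if k == 0 then p else q].

Section WedgeLast.
Variables (R : comPzRingType) (M N : lmodType R) (n : nat).
Variables (h : {linear M -> N}) (v : N).

Definition ffun_rcons (t : {ffun 'I_n -> M}) : {ffun 'I_n.+1 -> N} :=
  [ffun k => if unlift ord_max k is Some j then h (t j) else v].

(* The map x_1 /\ ... /\ x_n |-> h x_1 /\ ... /\ h x_n /\ v.                  *)
Definition wedge_last : extpow M n -> extpow N n.+1 :=
  ext_lift (fun t => wedge (ffun_rcons t)).

Lemma ffun_rcons_upd t i x :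
  ffun_rcons (upd t i x) = upd (ffun_rcons t) (lift ord_max i) (h x).
Proof.
apply/ffunP=> k; rewrite !ffunE.
case: unliftP => [j ->|->]; first by rewrite ffunE (inj_eq lift_inj); case: eqP.
by rewrite (negPf (neq_lift _ _)).
Qed.

Lemma wedge_last_altml :
  alternating_multilinear (fun t => wedge (ffun_rcons t)).
Proof.
split=> [t i c x y|t i j ij tij].
  by rewrite !ffun_rcons_upd linearP (altml_linear (wedge_altml N n.+1)).
apply: (altml_alt (wedge_altml N n.+1) (i := lift ord_max i)
  (j := lift ord_max j)); first by rewrite (inj_eq lift_inj).
by rewrite !ffunE !liftK tij.
Qed.

Lemma wedge_last_wedge t : wedge_last (wedge t) = wedge (ffun_rcons t).
Proof. exact: (ext_lift_wedge wedge_last_altml). Qed.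

HB.instance Definition _ := GRing.isLinear.Build R (extpow M n)
  (extpow N n.+1) _ wedge_last (ext_lift_linear wedge_last_altml).

End WedgeLast.

(** * Alternating isomorphisms *)

Section Forms.
Variable R : comPzRingType.

(* P is a direct summand of some R^n.                                         *)
Definition fg_projective (P : lmodType R) : Prop :=
  exists n (i : {linear P -> 'cV[R]_n}) (r : {linear 'cV[R]_n -> P}), cancel i r.

(* An alternating isomorphism f : P -> P^\vee is encoded by the form chi with *)
(* f q = chi (-) q; [alt_iso_bij] says that f is bijective.                   *)
Record alt_iso (P : lmodType R) (chi : P -> P -> R) : Prop := AltIso {
  alt_iso_linl : forall q, linear (chi^~ q : P -> R^o);
  alt_iso_linr : forall p, linear (chi p : P -> R^o);
  alt_iso_alt : forall p, chi p p = 0;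
  alt_iso_bij : forall phi : {linear P -> R^o},
    exists! q, forall p, chi p q = phi p }.

Definition mxform n (A : 'M[R]_n) (x y : 'cV[R]_n) : R := (x^T *m A *m y) 0 0.

Definition perp (P P' : lmodType R) (chi : P -> P -> R) (chi' : P' -> P' -> R)
  (x y : P * P') : R := chi x.1 y.1 + chi' x.2 y.2.

Definition pullback (P P' : Type) (h : P -> P') (chi : P' -> P' -> R) (x y : P)
  : R := chi (h x) (h y).

Definition mx_of_rows n (rows : seq (seq R)) : 'M[R]_n :=
  \matrix_(i, j) (nth [::] rows i)`_j.

Definition psi2 : 'M[R]_2 := mx_of_rows 2 [:: [:: 0; 1]; [:: -1; 0]].

Definition psi4 : 'M[R]_4 := block_mx psi2 0 0 psi2.

Lemma fg_projective_prod (P P' : lmodType R) :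
  fg_projective P -> fg_projective P' -> fg_projective (P * P')%type.
Proof.
move=> [n [i [r ri]]] [n' [i' [r' ri']]].
pose f (x : P * P') : 'cV[R]_(n + n') := col_mx (i x.1) (i' x.2).
pose g (v : 'cV[R]_(n + n')) : P * P' := (r (usubmx v), r' (dsubmx v)).
have f_lin : linear f.
  by move=> c x y; rewrite /f !linearP scale_col_mx add_col_mx.
have g_lin : linear g by move=> c x y; rewrite /g !linearP.
pose F : {linear (P * P')%type -> 'cV[R]_(n + n')} :=
  HB.pack f (GRing.isLinear.Build _ _ _ _ f f_lin).
pose G : {linear 'cV[R]_(n + n') -> (P * P')%type} :=
  HB.pack g (GRing.isLinear.Build _ _ _ _ g g_lin).
exists (n + n')%N, F, G => x.
by rewrite /= /g /f col_mxKu col_mxKd ri ri' -surjective_pairing.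
Qed.

Lemma alt_iso_perp (P P' : lmodType R) (chi : P -> P -> R)
    (chi' : P' -> P' -> R) :
  alt_iso chi -> alt_iso chi' ->
  alt_iso (perp chi chi' : (P * P')%type -> (P * P')%type -> R).
Proof.
move=> [l r a b] [l' r' a' b'].
have chi0 q : chi 0 q = 0.
  by have := l q (-1) 0 0; rewrite scaler0 addr0 scaleN1r addNr.
have chi'0 q : chi' 0 q = 0.
  by have := l' q (-1) 0 0; rewrite scaler0 addr0 scaleN1r addNr.
split=> [q c x y|p c x y|p|phi]; rewrite /perp /=.
- by rewrite l l' scalerDr addrACA.
- by rewrite r r' scalerDr addrACA.
- by rewrite a a' addr0.
have f_lin : linear (fun x : P => phi (x, 0)).
  by move=> c x y; rewrite -linearP; congr (phi (_, _)); rewrite /= scaler0 addr0.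
have g_lin : linear (fun x : P' => phi (0, x)).
  by move=> c x y; rewrite -linearP; congr (phi (_, _)); rewrite /= scaler0 addr0.
pose F : {linear P -> R^o} :=
  HB.pack (fun x : P => phi (x, 0)) (GRing.isLinear.Build _ _ _ _ _ f_lin).
pose G : {linear P' -> R^o} :=
  HB.pack (fun x : P' => phi (0, x)) (GRing.isLinear.Build _ _ _ _ _ g_lin).
have [q [qE qU]] := b F; have [q' [qE' qU']] := b' G.
exists (q, q'); split=> [[x x']|[y y'] yE] /=.
  rewrite qE qE' /= -linearD; congr (phi (_, _)); first by rewrite /= addr0.
  by rewrite /= add0r.
congr (_, _).
  by apply: qU => p; have := yE (p, 0); rewrite /= chi'0 addr0.
by apply: qU' => p; have := yE (0, p); rewrite /= chi0 add0r.
Qed.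

End Forms.

(** * The group V(R) *)

Section GroupV.
Variable R : comPzRingType.

Record pretriple := Pretriple {
  carrier : lmodType R;
  form0 : carrier -> carrier -> R;
  form1 : carrier -> carrier -> R }.

Record is_triple (T : pretriple) : Prop := IsTriple {
  carrierP : fg_projective (carrier T);
  form0P : alt_iso (@form0 T);
  form1P : alt_iso (@form1 T) }.

Record triple := Triple { pretriple_of :> pretriple; _ : is_triple pretriple_of }.

Definition isometric (T T' : triple) : Prop :=
  exists h : {linear carrier T -> carrier T'},
  [/\ bijective h,
      forall x y, form0 x y = form0 (h x) (h y) &
      forall x y, form1 x y = form1 (h x) (h y)].

Definition mk_triple (P : lmodType R) (g f : P -> P -> R) (hP : fg_projective P)
    (hg : alt_iso g) (hf : alt_iso f) : triple :=
  Triple (@IsTriple (Pretriple g f) hP hg hf).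

(* Elements of the free abelian group are signed words: (true, T) stands for  *)
(* [T] and (false, T) for - [T].                                              *)
Local Notation word := (seq (bool * triple)).

Inductive Veq : word -> word -> Prop :=
| Veq_refl u : Veq u u
| Veq_sym u v : Veq u v -> Veq v u
| Veq_trans u v w : Veq u v -> Veq v w -> Veq u w
| Veq_cat u u' v v' : Veq u u' -> Veq v v' -> Veq (u ++ v) (u' ++ v')
| Veq_catC u v : Veq (u ++ v) (v ++ u)
| Veq_cancel T : Veq [:: (true, T); (false, T)] [::]
| Veq_isometric T T' : isometric T T' -> Veq [:: (true, T)] [:: (true, T')]
| Veq_perp (P P' : lmodType R) (g f : P -> P -> R) (g' f' : P' -> P' -> R)
    (hP : fg_projective P) (hg : alt_iso g) (hf : alt_iso f)
    (hP' : fg_projective P') (hg' : alt_iso g') (hf' : alt_iso f') :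
    Veq [:: (true, mk_triple (fg_projective_prod hP hP')
                     (alt_iso_perp hg hg') (alt_iso_perp hf hf'))]
        [:: (true, mk_triple hP hg hf); (true, mk_triple hP' hg' hf')]
| Veq_comp (P : lmodType R) (f0 f1 f2 : P -> P -> R) (hP : fg_projective P)
    (h0 : alt_iso f0) (h1 : alt_iso f1) (h2 : alt_iso f2) :
    Veq [:: (true, mk_triple hP h0 h1); (true, mk_triple hP h1 h2)]
        [:: (true, mk_triple hP h0 h2)].

(* The set of [Veq]-classes of words.  It cannot be a [zmodType]: [triple]    *)
(* lives in a universe above the one of [choiceType].                         *)
Definition V : Type := {c : word -> Prop | exists u, c = Veq u}.

Definition Vpi (u : word) : V := exist _ (Veq u) (ex_intro _ u erefl).

Lemma VpiP u v : Vpi u = Vpi v <-> Veq u v.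
Proof.
split=> [/(congr1 sval) /= h|uv]; first by rewrite h; apply: Veq_refl.
apply: eq_exist; apply/funext=> w; apply/propext; split=> h.
  exact: Veq_trans (Veq_sym uv) h.
exact: Veq_trans uv h.
Qed.

Definition Vclass (T : pretriple) (hT : is_triple T) : V :=
  Vpi [:: (true, Triple hT)].

End GroupV.

(** * The generalized Vaserstein symbol *)

Section Kernel.
Variables (R : comPzRingType) (M : lmodType R) (a : {linear M -> R^o}).

Definition in_ker : {pred M} := [pred x | a x == 0].

Fact in_ker_submod_closed : submod_closed in_ker.
Proof.
split=> [|c x y]; rewrite !inE ?linear0 // => /eqP xK /eqP yK.
by rewrite linearP xK yK scaler0 addr0.
Qed.
HB.instance Definition _ :=
  GRing.isSubmodClosed.Build R M in_ker in_ker_submod_closed.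

Record kernel := Kernel { kernel_val :> M; _ : kernel_val \in in_ker }.
HB.instance Definition _ := [isSub for kernel_val].
HB.instance Definition _ := [Choice of kernel by <:].
HB.instance Definition _ := [SubChoice_isSubLmodule of kernel by <:].

Variables (s : {linear R^o -> M}) (sK : cancel s a).

Fact ker_proj_subproof (p : M) : p - s (a p) \in in_ker.
Proof. by rewrite inE linearB sK subrr. Qed.

Definition ker_proj (p : M) : kernel := Kernel (ker_proj_subproof p).

End Kernel.

Record trivialization (R : comPzRingType) (P0 : lmodType R) := Trivialization {
  triv_map :> {linear R^o -> extpow P0 2};
  triv_bij : bijective triv_map }.

Section GeneralizedVaserstein.
Variables (R : comPzRingType) (P0 : lmodType R) (vt : trivialization P0).
Local Notation inverse f := ('pinv_(fun=> 0) [set: _]%classic f).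

Definition chi0 (p q : P0) : R := inverse vt (wedge2 p q).

Local Notation P0R := ((P0 * R^o)%type : lmodType R).

Fact inl_linear : linear (fun p : P0 => (p, 0) : P0R).
Proof. by move=> c p q; congr (_, _); rewrite /= scaler0 addr0. Qed.

Definition inl0 (p : P0) : P0R := (p, 0).
HB.instance Definition _ := GRing.isLinear.Build R P0 P0R _ inl0 inl_linear.

Variables (a : {linear P0R -> R^o}) (s : {linear R^o -> P0R}).
Hypothesis sK : cancel s a.

(* det(P0) -> det(P0 (+) R) -> det(P(a)): w |-> w /\ e, followed by the       *)
(* inverse of w |-> w /\ s 1.                                                 *)
Definition det_e : extpow P0 2 -> extpow P0R 3 := wedge_last inl0 (0, 1).
Definition det_s : extpow (kernel a) 2 -> extpow P0R 3 :=
  wedge_last (val : {linear kernel a -> P0R}) (s 1).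
Definition theta_a (r : R) : extpow (kernel a) 2 := inverse det_s (det_e (vt r)).

Definition chi_a (p q : kernel a) : R := inverse theta_a (wedge2 p q).

(* i (+) 1 : P0 (+) R^2 -> P(a) (+) R^2 where i acts on P0 and on the first   *)
(* coordinate of R^2.                                                         *)
Definition i_plus_1 (x : P0 * 'cV[R]_2) : kernel a * 'cV[R]_2 :=
  let p : P0R := (x.1, x.2 0 0) in
  (ker_proj sK p, \col_(k < 2) if k == 0 then a p else x.2 k 0).

(* The triple representing V_vt(a). That it satisfies [is_triple] is left to  *)
(* be established where its class in V(R) is formed; the total inverses used  *)
(* above are genuine inverses whenever P0 is projective of rank 2.            *)
Definition gen_vaserstein : pretriple R :=
  @Pretriple R (P0 * 'cV[R]_2)%type
    (perp chi0 (mxform (psi2 R)))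
    (pullback i_plus_1 (perp chi_a (mxform (psi2 R)))).

End GeneralizedVaserstein.

(** * The case P0 = R^2 *)

Section FreeRank2.
Variable R : comPzRingType.
Local Notation R2 := 'cV[R]_2.

Definition std (i : 'I_2) : R2 := delta_mx i 0.

Definition theta0_fun (r : R^o) : extpow R2 2 := (r : R) *: wedge2 (std 0) (std 1).

Fact theta0_linear : linear theta0_fun.
Proof. by move=> c x y; rewrite /theta0_fun scalerDl scalerA. Qed.
HB.instance Definition _ :=
  GRing.isLinear.Build R R^o (extpow R2 2) _ theta0_fun theta0_linear.

Definition det2 (t : {ffun 'I_2 -> R2}) : R^o :=
  t 0 0 0 * t 1 1 0 - t 0 1 0 * t 1 0 0.

Lemma ord2_case (i : 'I_2) : i = 0 \/ i = 1.
Proof. by case: i => -[|[|//]] h; [left|right]; apply: val_inj. Qed.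

Lemma det2_altml : alternating_multilinear det2.
Proof.
split=> [t i c x y|t i j ij tij].
  have [-> | ->] := ord2_case i; rewrite /det2 !ffunE /= !mxE.
    rewrite scalerBr addrACA -opprD /GRing.scale /=.
    by rewrite !mulrDl !mulrA.
  rewrite scalerBr addrACA -opprD /GRing.scale /=.
  by rewrite !mulrDr !mulrA ![_ * c]mulrC.
rewrite /det2; have -> : t 1 = t 0.
  by move: ij tij; have [-> | ->] := ord2_case i; have [-> | ->] := ord2_case j.
by rewrite mulrC subrr.
Qed.

Lemma wedge2Pl (M : lmodType R) c (x y q : M) :
  wedge2 (c *: x + y) q = c *: wedge2 x q + wedge2 y q.
Proof.
have E z : wedge2 z q = wedge (upd [ffun=> q] 0 z).
  by congr wedge; apply/ffunP=> k; rewrite !ffunE.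
by rewrite !E (altml_linear (wedge_altml M 2)).
Qed.

Lemma wedge2Pr (M : lmodType R) c (p x y : M) :
  wedge2 p (c *: x + y) = c *: wedge2 p x + wedge2 p y.
Proof.
have E z : wedge2 p z = wedge (upd [ffun=> p] 1 z).
  congr wedge; apply/ffunP=> k; rewrite !ffunE.
  by have [-> | ->] := ord2_case k.
by rewrite !E (altml_linear (wedge_altml M 2)).
Qed.

Lemma wedge2xx (M : lmodType R) (p : M) : wedge2 p p = 0.
Proof.
apply: (altml_alt (wedge_altml M 2) (i := 0) (j := 1)) => //.
by rewrite !ffunE.
Qed.

Lemma wedge2C (M : lmodType R) (p q : M) : wedge2 q p = - wedge2 p q.
Proof.
have := wedge2xx (1 *: p + q).
rewrite wedge2Pl !wedge2Pr !wedge2xx !scale1r add0r addr0 => /eqP.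
by rewrite addrC addr_eq0 => /eqP.
Qed.

Lemma std_sum (p : R2) : p = p 0 0 *: std 0 + p 1 0 *: std 1.
Proof.
apply/matrixP=> i j; rewrite [j]ord1 !mxE.
by have [-> | ->] := ord2_case i; rewrite /= ?mulr1 ?mulr0 ?addr0 ?add0r.
Qed.

Lemma wedge2_std (p q : R2) :
  wedge2 p q = (p 0 0 * q 1 0 - p 1 0 * q 0 0) *: wedge2 (std 0) (std 1).
Proof.
rewrite {1}[p]std_sum wedge2Pl -[p 1 0 *: _]addr0 wedge2Pl.
have w0 : wedge2 0 q = 0.
  by have := wedge2Pl (-1) 0 0 q; rewrite scaler0 addr0 scaleN1r addNr.
have z (p' : R2) : wedge2 p' 0 = 0.
  by have := wedge2Pr (-1) p' 0 0; rewrite scaler0 addr0 scaleN1r addNr.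
rewrite w0 addr0 [q in LHS]std_sum -[q 1 0 *: _]addr0 !wedge2Pr !z !wedge2xx.
rewrite !scaler0 !addr0 !add0r (wedge2C (std 0) (std 1)) scalerN scalerN.
by rewrite !scalerA scalerBl.
Qed.

Fact theta0_bij : bijective theta0_fun.
Proof.
have l := ext_lift_linear det2_altml.
exists (ext_lift det2) => [r|w].
  rewrite /theta0_fun -[_ *: _]addr0 l.
  have -> : ext_lift det2 0 = 0.
    by have := l (-1) 0 0; rewrite scaler0 addr0 scaleN1r addNr.
  rewrite addr0 (ext_lift_wedge det2_altml) /det2 !ffunE /= !mxE /=.
  by rewrite mulr1 mulr0 subr0; apply: mulr1.
elim/ext_wedge_ind: w => [|c t x ih].
  have -> : ext_lift det2 0 = 0.
    by have := l (-1) 0 0; rewrite scaler0 addr0 scaleN1r addNr.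
  exact: scale0r.
rewrite l theta0_linear ih; congr (_ *: _ + _).
rewrite (ext_lift_wedge det2_altml) /theta0_fun -wedge2_std.
congr wedge; apply/ffunP=> k; rewrite !ffunE.
by have [-> | ->] := ord2_case k.
Qed.

Definition theta0 : trivialization R2 :=
  @Trivialization R R2 (theta0_fun : {linear R^o -> extpow R2 2}) theta0_bij.

End FreeRank2.

Section OppTrivialization.
Variables (R : comPzRingType) (P0 : lmodType R) (vt : trivialization P0).

Definition opp_triv_fun (r : R^o) : extpow P0 2 := - vt r.

Fact opp_triv_linear : linear opp_triv_fun.
Proof. by move=> c x y; rewrite /opp_triv_fun linearP opprD scalerN. Qed.
HB.instance Definition _ :=
  GRing.isLinear.Build R R^o (extpow P0 2) _ opp_triv_fun opp_triv_linear.

Fact opp_triv_bij : bijective opp_triv_fun.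
Proof.
have [g vK gK] := triv_bij vt.
by exists (g \o -%R) => x; rewrite /opp_triv_fun /= ?opprK ?gK ?opprK.
Qed.

Definition opp_triv : trivialization P0 :=
  @Trivialization R P0 (opp_triv_fun : {linear R^o -> extpow P0 2}) opp_triv_bij.

End OppTrivialization.

(** * Unimodular rows of length 3 *)

Section Rows.
Variables (R : comPzRingType) (a b : 'rV[R]_3).

Definition row_map (x : 'cV[R]_2 * R^o) : R^o :=
  (a *m (col_mx x.1 (x.2 : R)%:M : 'cV[R]_(2 + 1))) 0 0.

Fact row_map_linear : linear row_map.
Proof.
move=> c x y; rewrite /row_map /= raddfD /= -scale_scalar_mx.
by rewrite -add_col_mx -scale_col_mx mulmxDr -scalemxAr !mxE.
Qed.
HB.instance Definition _ :=
  GRing.isLinear.Build R ('cV[R]_2 * R^o)%type R^o _ row_map row_map_linear.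

Definition vaserstein_mx : 'M[R]_4 :=
  let a1 := a 0 0 in let a2 := a 0 1 in let a3 := a 0 2 in
  let b1 := b 0 0 in let b2 := b 0 1 in let b3 := b 0 2 in
  mx_of_rows 4 [:: [::  0; - a1; - a2; - a3];
                   [:: a1;    0; - b3;   b2];
                   [:: a2;   b3;    0; - b1];
                   [:: a3; - b2;   b1;    0]].

End Rows.

(* The triple (R^n, N, M) given by two n x n matrices.                        *)
Definition mx_pretriple (R : comPzRingType) n (N M : 'M[R]_n) : pretriple R :=
  @Pretriple R 'cV[R]_n (mxform N) (mxform M).

(* Main.v *)
(**
In V(R), the class [P, f, x^t f x] is additive in the automorphism x of P, hence
vanishes when x is a commutator.

Writing D(p, q) = det (p, q, s(1)), one has p /\ q = D(p, q) w in det (ker a) for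
a fixed w with w /\ s(1) = e_1 /\ e_2 /\ e_3, so that for the trivialization
- theta_0 the form chi_a is - D. Therefore, in the coordinates (x_4, x_1, x_2, x_3)
of R^2 + R^2, the second form of V_(- theta_0)(a) has matrix V(a, s(1)), while the
first is psi_4 pulled back along a cyclic permutation of three coordinates, which
is a commutator.

Finally V(a, s(1)) is carried to V(a, b) by 1 + e_1 k, where the row k is the
cross product of s(1) and b. For G in GL_4 fixing e_1, the commutator of 1 + e_1 l
and G is of the form 1 + e_1 (l G - l), and every row k with k e_1 = 0 can be
written l G - l for a suitable G, so 1 + e_1 k is a commutator too.
*)

From HB Require Import structures.
Require Import Defs.
From mathcomp Require Import all_boot all_order all_algebra all_fingroup ring.
From mathcomp Require Import all_classical.
Set Implicit Arguments.
Unset Strict Implicit.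
Unset Printing Implicit Defensive.
Import GRing.Theory.
Local Open Scope ring_scope.

(** * Cancellation, pullbacks and commutators in V(R) *)

Section VRelations.
Variable R : comPzRingType.
Implicit Types (P : lmodType R) (u v w : seq (bool * triple R)).

(** Prepending the formal negative of [T] removes it. [Veq_cancel] has the positive letter first,
    hence the swap by [Veq_catC]. *)
Lemma Veq_cancel_cat (T : triple R) u v :
  Veq ((true, T) :: u) ((true, T) :: v) -> Veq u v.
Proof.
have E w : Veq ([:: (false, T)] ++ (true, T) :: w) w.
  apply: Veq_trans (_ : Veq _ ([:: (true, T); (false, T)] ++ w)) _.
    by apply: (Veq_cat (Veq_catC [:: _] [:: _]) (Veq_refl w)).
  exact: (Veq_cat (Veq_cancel T) (Veq_refl w)).
move=> uv; apply: Veq_trans (Veq_sym (E u)) _; apply: Veq_trans (E v).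
exact: Veq_cat (Veq_refl _) uv.
Qed.

(** A functional [phi] on [P] is represented by the preimage under [h] of the vector that represents
    [phi] composed with the inverse of [h]. *)
Lemma alt_iso_pullback P P' (h : {linear P -> P'}) (f : P' -> P' -> R) :
  bijective h -> alt_iso f -> alt_iso (pullback h f).
Proof.
move=> [g hK gK] [fl fr fa fb]; split=> [q c x y|p c x y|p|phi]; rewrite /pullback.
- by rewrite linearP fl.
- by rewrite linearP fr.
- exact: fa.
have g_lin : linear (fun x => phi (g x)).
  move=> c x y; rewrite -linearP; congr (phi _); apply: (can_inj hK).
  by rewrite linearP !gK.
pose F : {linear P' -> R^o} :=
  HB.pack (fun x => phi (g x)) (GRing.isLinear.Build _ _ _ _ _ g_lin).
have [q [qE qU]] := fb F; exists (g q); split=> [p|q' q'E].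
  by rewrite gK qE /= hK.
by rewrite (qU (h q')) ?hK // => p; rewrite -[p]gK q'E /= gK.
Qed.

Lemma Veq_pullback P P' (h : {linear P -> P'}) (g f : P' -> P' -> R)
    (hP : fg_projective P) (hP' : fg_projective P')
    (hg : alt_iso g) (hf : alt_iso f)
    (hg' : alt_iso (pullback h g)) (hf' : alt_iso (pullback h f)) :
  bijective h ->
  Veq [:: (true, mk_triple hP hg' hf')] [:: (true, mk_triple hP' hg hf)].
Proof. by move=> h_bij; apply: Veq_isometric; exists h. Qed.

(** Pulling back along [x \o y] is pulling back along [x], then along [y], so the class splits at
    [pullback y f]. The isometry [y] carries the second half to the class of [f] and
    [pullback x f]. *)
Lemma Veq_pullback_comp P (hP : fg_projective P) (f : P -> P -> R)
    (x y : {linear P -> P}) (hf : alt_iso f)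
    (hx : alt_iso (pullback x f)) (hy : alt_iso (pullback y f))
    (hxy : alt_iso (pullback (x \o y) f)) :
  bijective y ->
  Veq [:: (true, mk_triple hP hf hxy)]
      [:: (true, mk_triple hP hf hy); (true, mk_triple hP hf hx)].
Proof.
move=> y_bij.
apply: Veq_trans (Veq_sym (Veq_comp hP hf hy hxy)) _.
apply: (Veq_cat (Veq_refl [:: _])).
exact: (@Veq_pullback _ _ y _ _ hP hP hf hx hy hxy).
Qed.

(** Write [[z]] for the class of [f] and [pullback z f]. By additivity, [x y = y x k] yields [[x] +
    [y] = [y] + [x] + [k]], and cancellation leaves [[k] = 0]. *)
Lemma Veq_commutator P (hP : fg_projective P) (f : P -> P -> R)
    (x y k : {linear P -> P}) (hf : alt_iso f) (hk : alt_iso (pullback k f)) :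
  bijective x -> bijective y -> bijective k -> x \o y =1 y \o x \o k ->
  Veq [:: (true, mk_triple hP hf hk)] [::].
Proof.
move=> x_bij y_bij k_bij xyk.
have hx := alt_iso_pullback x_bij hf; have hy := alt_iso_pullback y_bij hf.
pose xy : {linear P -> P} := x \o y.
pose yx : {linear P -> P} := y \o x.
have yx_bij : bijective yx by apply: bij_comp.
have hxy : alt_iso (pullback xy f) by apply: alt_iso_pullback => //; apply: bij_comp.
have hyx := alt_iso_pullback yx_bij hf.
have hyxk : alt_iso (pullback (yx \o k) f).
  by apply: (@alt_iso_pullback _ _ (yx \o k)) => //; apply: bij_comp.
have c_xy := Veq_pullback_comp hP hf hx hy hxy y_bij.
have c_yx := Veq_pullback_comp hP hf hy hx hyx x_bij.
have c_yxk := Veq_pullback_comp hP hf hyx hk hyxk k_bij.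
(* The two second forms agree pointwise, so the identity is an isometry. *)
have c_eq : Veq [:: (true, mk_triple hP hf hxy)] [:: (true, mk_triple hP hf hyxk)].
  apply: Veq_isometric; exists (idfun : {linear P -> P}).
  split=> [|//|u v]; first by exists idfun.
  by rewrite /= /pullback -![xy _]/((x \o y) _) !xyk.
apply: Veq_sym.
apply: (@Veq_cancel_cat (mk_triple hP hf hx)).
apply: (@Veq_cancel_cat (mk_triple hP hf hy)).
apply: Veq_trans (Veq_trans (Veq_sym c_xy) (Veq_trans c_eq c_yxk)) _.
apply: Veq_trans (Veq_cat (Veq_refl [:: _]) c_yx) _.
apply: Veq_trans (Veq_catC [:: _] [:: _; _]) _.
exact: (Veq_cat (Veq_catC [:: _] [:: _]) (Veq_refl [:: _])).
Qed.

End VRelations.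

(** * Alternating forms given by matrices *)

Section FourByFour.
Variable R : comPzRingType.

Lemma sum_ord3 (V : nmodType) (F : 'I_3 -> V) : \sum_i F i = F 0 + F 1 + F 2.
Proof.
rewrite !big_ord_recl big_ord0 addr0 addrA.
by congr (_ + F _ + F _); apply: val_inj.
Qed.

Lemma sum_ord4 (V : nmodType) (F : 'I_4 -> V) :
  \sum_i F i = F 0 + F 1 + F 2 + F 3.
Proof.
rewrite !big_ord_recl big_ord0 addr0 !addrA.
by congr (_ + F _ + F _ + F _); apply: val_inj.
Qed.

Lemma ord4P (P : 'I_4 -> Prop) : P 0 -> P 1 -> P 2 -> P 3 -> forall i, P i.
Proof.
move=> h0 h1 h2 h3 [[|[|[|[|//]]]] h].
- by have -> : Ordinal h = 0 by apply: val_inj.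
- by have -> : Ordinal h = 1 by apply: val_inj.
- by have -> : Ordinal h = 2 by apply: val_inj.
- by have -> : Ordinal h = 3 by apply: val_inj.
Qed.

Lemma mulmx_bij n (X Y : 'M[R]_n) :
  X *m Y = 1%:M -> Y *m X = 1%:M -> bijective (mulmx X : 'cV[R]_n -> 'cV[R]_n).
Proof.
by move=> XY YX; exists (mulmx Y) => x; rewrite mulmxA ?XY ?YX mul1mx.
Qed.

Lemma fg_projective_cV n : fg_projective 'cV[R]_n.
Proof. by exists n, idfun, idfun. Qed.

Lemma mxform_alt_iso n (N N' : 'M[R]_n) :
  (forall x, mxform N x x = 0) -> N *m N' = 1%:M -> N' *m N = 1%:M ->
  alt_iso (mxform N).
Proof.
move=> Nalt NN' N'N; split=> // [q c x y|p c x y|phi]; rewrite /mxform.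
- by rewrite linearP /= !mulmxDl -!scalemxAl !mxE.
- by rewrite linearP /= mxE [in LHS]mxE.
(* As [phi p = p^T w], the representing vector must be [N^-1 w]. *)
pose w : 'cV[R]_n := \col_i phi (delta_mx i 0).
have phiE p : phi p = (p^T *m w) 0 0.
  rewrite mxE [p in phi p]matrix_sum_delta linear_sum; apply: eq_bigr => i _.
  by rewrite big_ord1 linearZ !mxE.
exists (N' *m w); split=> [p|q qE]; first by rewrite phiE mulmxA -(mulmxA _ N) NN' mulmx1.
have -> : w = N *m q.
  apply/matrixP=> i j; rewrite ord1 mxE -qE -mulmxA trmx_delta -rowE.
  by rewrite mxE.
by rewrite mulmxA N'N mul1mx.
Qed.

(** With [x = (x_0, x')], this is [(a.x') y_0 - x_0 (a.y') - b.(x' × y')]. *)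
Lemma mxform_vaserstein (a b : 'rV[R]_3) (x y : 'cV[R]_4) :
  mxform (vaserstein_mx a b) x y =
    a 0 0 * (x 1 0 * y 0 0 - x 0 0 * y 1 0) +
    a 0 1 * (x 2 0 * y 0 0 - x 0 0 * y 2 0) +
    a 0 2 * (x 3 0 * y 0 0 - x 0 0 * y 3 0) +
    b 0 0 * (x 3 0 * y 2 0 - x 2 0 * y 3 0) +
    b 0 1 * (x 1 0 * y 3 0 - x 3 0 * y 1 0) +
    b 0 2 * (x 2 0 * y 1 0 - x 1 0 * y 2 0).
Proof.
by rewrite /mxform mxE sum_ord4 !mxE !sum_ord4 !mxE /=; ring.
Qed.

(** [V(a, b)] has Pfaffian [a.b], and [- V(b, a)] is its Pfaffian adjoint: their product is the
    scalar matrix [a.b]. *)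
Lemma vaserstein_mul (a b : 'rV[R]_3) :
  \sum_i a 0 i * b 0 i = 1 ->
  vaserstein_mx a b *m (- vaserstein_mx b a) = 1%:M.
Proof.
rewrite sum_ord3 => ab.
apply/matrixP; elim/ord4P; elim/ord4P; rewrite !mxE sum_ord4 !mxE /=;
  rewrite ?mulr1n ?mulr0n -?ab; ring.
Qed.

Lemma vaserstein_alt_iso (a b : 'rV[R]_3) :
  \sum_i a 0 i * b 0 i = 1 -> alt_iso (mxform (vaserstein_mx a b)).
Proof.
move=> ab; apply: (@mxform_alt_iso _ _ (- vaserstein_mx b a)).
- by move=> x; rewrite mxform_vaserstein; ring.
- exact: vaserstein_mul.
- rewrite mulNmx -mulmxN; apply: vaserstein_mul.
  by rewrite -[RHS]ab; apply: eq_bigr => i _; rewrite mulrC.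
Qed.

(** Makes the computations for [V(a, b)] available for [psi4]. *)
Lemma psi4_vaserstein :
  psi4 R = vaserstein_mx (- delta_mx 0 0) (- delta_mx 0 0).
Proof.
apply/matrixP; elim/ord4P; elim/ord4P; rewrite !mxE;
  do 2? [case: splitP => //= -[] [|[|]] //= ? _; rewrite ?mxE]; rewrite /=; ring.
Qed.

Lemma psi4_alt_iso : alt_iso (mxform (psi4 R)).
Proof.
rewrite psi4_vaserstein; apply: vaserstein_alt_iso.
by rewrite sum_ord3 !mxE /=; ring.
Qed.

Lemma mxform_psi2 (x y : 'cV[R]_2) :
  mxform (psi2 R) x y = x 0 0 * y 1 0 - x 1 0 * y 0 0.
Proof.
rewrite /mxform mxE !big_ord_recl big_ord0 !mxE !big_ord_recl !big_ord0 !mxE /=.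
have -> : lift ord0 ord0 = 1 :> 'I_2 by apply: val_inj.
by have -> : ord0 = 0 :> 'I_2 by []; ring.
Qed.

Lemma mxform_psi4 (x y : 'cV[R]_4) :
  mxform (psi4 R) x y =
    x 0 0 * y 1 0 - x 1 0 * y 0 0 + (x 2 0 * y 3 0 - x 3 0 * y 2 0).
Proof. by rewrite psi4_vaserstein mxform_vaserstein !mxE /=; ring. Qed.

End FourByFour.

(** * Vanishing of classes attached to commutators of matrices *)

Section Commutators.
Variable R : comPzRingType.

Lemma Veq_mx_commutator n (f : 'cV[R]_n -> 'cV[R]_n -> R)
    (X X' Y Y' K K' : 'M[R]_n) (hf : alt_iso f)
    (hk : alt_iso (pullback (mulmx K) f)) :
  X *m X' = 1%:M -> X' *m X = 1%:M -> Y *m Y' = 1%:M -> Y' *m Y = 1%:M ->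
  K *m K' = 1%:M -> K' *m K = 1%:M -> X *m Y = Y *m X *m K ->
  Veq [:: (true, mk_triple (fg_projective_cV R n) hf hk)] [::].
Proof.
move=> XX' X'X YY' Y'Y KK' K'K XYK.
apply: (@Veq_commutator _ _ _ _ (mulmx X) (mulmx Y) (mulmx K)).
- exact: mulmx_bij XX' X'X.
- exact: mulmx_bij YY' Y'Y.
- exact: mulmx_bij KK' K'K.
- by move=> v; rewrite /= mulmxA XYK !mulmxA.
Qed.

(** The cross term [e (l e) m] vanishes. *)
Lemma transvection_mul n (e : 'cV[R]_n) (l m : 'rV[R]_n) :
  l *m e = 0 -> (1%:M + e *m l) *m (1%:M + e *m m) = 1%:M + e *m (l + m).
Proof.
move=> le; rewrite mulmxDr mulmx1 mulmxDl mul1mx !mulmxA -(mulmxA e l e) le.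
by rewrite mulmx0 mul0mx addr0 mulmxDr addrA addrAC -!addrA [e *m m + _]addrC.
Qed.

Lemma transvectionK n (e : 'cV[R]_n) (l : 'rV[R]_n) :
  l *m e = 0 -> (1%:M + e *m l) *m (1%:M + e *m - l) = 1%:M.
Proof. by move=> le; rewrite transvection_mul // subrr mulmx0 addr0. Qed.

(** Because [G e = e] and [l e = 0], both [(1 + e l) G] and [G (1 + e l) (1 + e (l G - l))] equal
    [G + e l G]. *)
Lemma Veq_transvection n (f : 'cV[R]_n -> 'cV[R]_n -> R) (e : 'cV[R]_n)
    (l : 'rV[R]_n) (G H : 'M[R]_n) (hf : alt_iso f)
    (hk : alt_iso (pullback (mulmx (1%:M + e *m (l *m G - l))) f)) :
  G *m H = 1%:M -> H *m G = 1%:M -> G *m e = e -> l *m e = 0 ->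
  Veq [:: (true, mk_triple (fg_projective_cV R n) hf hk)] [::].
Proof.
move=> GH HG Ge le.
have lNe m : m *m e = 0 -> - m *m e = 0 by rewrite mulNmx => ->; rewrite oppr0.
have ke : (l *m G - l) *m e = 0 by rewrite mulmxBl -mulmxA Ge le subrr.
apply: (@Veq_mx_commutator n f (1%:M + e *m l) (1%:M + e *m - l) G H _
         (1%:M + e *m - (l *m G - l))) => //.
- exact: transvectionK.
- by rewrite -{2}[l]opprK transvectionK ?lNe.
- exact: transvectionK.
- by rewrite -{2}[_ - l]opprK transvectionK ?lNe.
rewrite -mulmxA transvection_mul // [l + _]addrC subrK mulmxDl mul1mx mulmxDr mulmx1.
by rewrite !mulmxA Ge.
Qed.

Lemma Veq_unipotent (f : 'cV[R]_4 -> 'cV[R]_4 -> R) (k : 'rV[R]_4)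
    (hf : alt_iso f)
    (hk : alt_iso (pullback (mulmx (1%:M + delta_mx 0 0 *m k)) f)) :
  k 0 0 = 0 -> Veq [:: (true, mk_triple (fg_projective_cV R 4) hf hk)] [::].
Proof.
move=> k0.
(* [G] is the block sum of [1] and the companion matrix [A] of [X^3 - X - 1]: *)
(* [A] has inverse [A^2 - 1] and [A - 1] has inverse [A^2 + A].               *)
pose G : 'M[R]_4 := mx_of_rows 4 [:: [:: 1; 0; 0; 0]; [:: 0; 0; 1; 0];
                                     [:: 0; 0; 0; 1]; [:: 0; 1; 1; 0]].
pose H : 'M[R]_4 := mx_of_rows 4 [:: [:: 1; 0; 0; 0]; [:: 0; -1; 0; 1];
                                     [:: 0; 1; 0; 0]; [:: 0; 0; 1; 0]].
(* On the last three coordinates [l] is [k (A^2 + A)], that is, [k] times the inverse of [A - 1]. *)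
pose l : 'rV[R]_4 := \row_j [:: 0; k 0 2 + k 0 3; k 0 1 + k 0 2 + k 0 3 *+ 2;
                              k 0 1 + k 0 2 + k 0 3]`_j.
have kE : k = l *m G - l.
  apply/matrixP=> i; rewrite [i]ord1 {i}.
  by elim/ord4P; rewrite !mxE sum_ord4 !mxE /= ?k0; ring.
revert hk; rewrite kE => hk; apply: (@Veq_transvection _ _ _ _ G H).
- apply/matrixP; elim/ord4P; elim/ord4P; rewrite !mxE sum_ord4 !mxE /=;
    rewrite ?mulr1n ?mulr0n; ring.
- apply/matrixP; elim/ord4P; elim/ord4P; rewrite !mxE sum_ord4 !mxE /=;
    rewrite ?mulr1n ?mulr0n; ring.
- apply/matrixP=> i j; rewrite [j]ord1 {j}; move: i.
  by elim/ord4P; rewrite !mxE sum_ord4 !mxE /=; ring.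
- by apply/matrixP=> i j; rewrite [j]ord1 [i]ord1 !mxE sum_ord4 !mxE /=; ring.
Qed.

(** Replacing [x_0] by [x_0 + k.x'] adds [(a.x') (k.y') - (k.x') (a.y') = (a × k).(x' × y')] to the
    form, which turns [s] into [s - a × k]. *)
Lemma pullback_vaserstein (a b s : 'rV[R]_3) (k : 'rV[R]_4) :
  k 0 0 = 0 ->
  b 0 0 = s 0 0 - (a 0 1 * k 0 3 - a 0 2 * k 0 2) ->
  b 0 1 = s 0 1 - (a 0 2 * k 0 1 - a 0 0 * k 0 3) ->
  b 0 2 = s 0 2 - (a 0 0 * k 0 2 - a 0 1 * k 0 1) ->
  mxform (vaserstein_mx a b) =
    pullback (mulmx (1%:M + delta_mx 0 0 *m k)) (mxform (vaserstein_mx a s)).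
Proof.
move=> k0 b0 b1 b2; apply/funext=> x; apply/funext=> y.
have kE (z : 'cV[R]_4) i : ((1%:M + delta_mx 0 0 *m k) *m z) i 0 =
    z i 0 + (i == 0)%:R * (k 0 1 * z 1 0 + k 0 2 * z 2 0 + k 0 3 * z 3 0).
  rewrite mulmxDl mul1mx -mulmxA !mxE big_ord1 !mxE sum_ord4 k0 mul0r add0r.
  by rewrite andbT.
rewrite /pullback !mxform_vaserstein !kE /= b0 b1 b2.
by rewrite !mul0r !addr0 !mul1r; ring.
Qed.

Lemma Veq_vaserstein (a b s : 'rV[R]_3) (hs : alt_iso (mxform (vaserstein_mx a s)))
    (hb : alt_iso (mxform (vaserstein_mx a b))) :
  \sum_i a 0 i * b 0 i = 1 -> \sum_i a 0 i * s 0 i = 1 ->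
  Veq [:: (true, mk_triple (fg_projective_cV R 4) hs hb)] [::].
Proof.
rewrite !sum_ord3 => ab as1.
(* the cross product [s x b]: as [a.b = a.s = 1], [a x (s x b) = s - b]       *)
pose k : 'rV[R]_4 := \row_j [:: 0; s 0 1 * b 0 2 - s 0 2 * b 0 1;
  s 0 2 * b 0 0 - s 0 0 * b 0 2; s 0 0 * b 0 1 - s 0 1 * b 0 0]`_j.
(* Inserting [a.b] and [a.s] where they equal 1 turns the required equations into the polynomial
   identity [a × (s × b) = s (a.b) - b (a.s)]. *)
have bE i : b 0 i = s 0 i - (s 0 i * (a 0 0 * b 0 0 + a 0 1 * b 0 1 + a 0 2 * b 0 2)
                    - b 0 i * (a 0 0 * s 0 0 + a 0 1 * s 0 1 + a 0 2 * s 0 2)).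
  by rewrite ab as1 !mulr1 subKr.
have k0 : k 0 0 = 0 by rewrite mxE.
have E : mxform (vaserstein_mx a b) =
    pullback (mulmx (1%:M + delta_mx 0 0 *m k)) (mxform (vaserstein_mx a s)).
  by apply: pullback_vaserstein; rewrite // [LHS]bE !mxE /=; ring.
by revert hb; rewrite E => hb; apply: Veq_unipotent.
Qed.

(** The 3-cycle 0, 3, 1, written as a commutator of transpositions so that its permutation matrix is
    visibly a commutator. *)
Local Notation cyc := [~ tperm 0%R 1%R, tperm 0%R 3%R : 'S_4]%g.

Lemma commg_tpermE : [/\ cyc 0 = 3, cyc 1 = 0, cyc 2 = 2 & cyc 3 = 1].
Proof.
have tE (x y z : 'I_4) : tperm x y z = if z == x then y else if z == y then x else z.
  by case: tpermP => [->|->|/eqP/negPf-> /eqP/negPf->]; rewrite ?eqxx //; case: (y =P x).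
by rewrite commgEl conjgE !tpermV; split; rewrite !permM !tE.
Qed.

Lemma Veq_psi4 (hf : alt_iso (mxform (psi4 R)))
    (hk : alt_iso (pullback (mulmx (perm_mx cyc)) (mxform (psi4 R)))) :
  Veq [:: (true, mk_triple (fg_projective_cV R 4) hf hk)] [::].
Proof.
have permK (s : 'S_4) : perm_mx s *m perm_mx s^-1 = 1%:M :> 'M[R]_4.
  by rewrite -perm_mxM mulgV perm_mx1.
have permVK (s : 'S_4) : perm_mx s^-1 *m perm_mx s = 1%:M :> 'M[R]_4.
  by rewrite -perm_mxM mulVg perm_mx1.
apply: (Veq_mx_commutator hf hk (permK (tperm 0 1)) (permVK _)
  (permK (tperm 0 3)) (permVK _) (permK cyc) (permVK _)).
by rewrite -!perm_mxM -commgC.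
Qed.

(** Coordinates 3 and 0 carry [psi2], coordinates 1 and 2 carry [- psi2]: this is the first form of
    the symbol for [- theta_0], read through [coord4]. *)
Lemma mxform_psi4_cyc (x y : 'cV[R]_4) :
  pullback (mulmx (perm_mx cyc)) (mxform (psi4 R)) x y =
    x 3 0 * y 0 0 - x 0 0 * y 3 0 - (x 1 0 * y 2 0 - x 2 0 * y 1 0).
Proof.
have [c0 c1 c2 c3] := commg_tpermE.
by rewrite /pullback mxform_psi4 -!row_permE !mxE c0 c1 c2 c3; ring.
Qed.

Lemma psi4_cyc_alt_iso :
  alt_iso (pullback (mulmx (perm_mx cyc)) (mxform (psi4 R))).
Proof.
apply: alt_iso_pullback (psi4_alt_iso R).
by apply: (@mulmx_bij _ _ _ (perm_mx cyc^-1)); rewrite -perm_mxM ?mulgV ?mulVg perm_mx1.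
Qed.

End Commutators.

(** * Calculus in exterior squares and cubes *)

Section Wedge3.
Variables (R : comPzRingType) (M : lmodType R).
Implicit Types (c : R) (x y z v : M).

Definition ffun3 x y z : {ffun 'I_3 -> M} :=
  [ffun k : 'I_3 => if k == 0 then x else if k == 1 then y else z].

Definition wedge3 x y z : extpow M 3 := wedge (ffun3 x y z).

Lemma ord3P (P : 'I_3 -> Prop) : P 0 -> P 1 -> P 2 -> forall i, P i.
Proof.
move=> h0 h1 h2 [[|[|[|//]]] h].
- by have -> : Ordinal h = 0 by apply: val_inj.
- by have -> : Ordinal h = 1 by apply: val_inj.
- by have -> : Ordinal h = 2 by apply: val_inj.
Qed.

Lemma wedge3Pl c x v y z :
  wedge3 (c *: x + v) y z = c *: wedge3 x y z + wedge3 v y z.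
Proof.
have E u : wedge3 u y z = wedge (upd (ffun3 0 y z) 0 u).
  by congr wedge; apply/ffunP; elim/ord3P; rewrite !ffunE.
by rewrite !E (altml_linear (wedge_altml M 3)).
Qed.

Lemma wedge3Pm c x v y z :
  wedge3 y (c *: x + v) z = c *: wedge3 y x z + wedge3 y v z.
Proof.
have E u : wedge3 y u z = wedge (upd (ffun3 y 0 z) 1 u).
  by congr wedge; apply/ffunP; elim/ord3P; rewrite !ffunE.
by rewrite !E (altml_linear (wedge_altml M 3)).
Qed.

Lemma wedge3Pr c x v y z :
  wedge3 y z (c *: x + v) = c *: wedge3 y z x + wedge3 y z v.
Proof.
have E u : wedge3 y z u = wedge (upd (ffun3 y z 0) 2 u).
  by congr wedge; apply/ffunP; elim/ord3P; rewrite !ffunE.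
by rewrite !E (altml_linear (wedge_altml M 3)).
Qed.

Lemma wedge3_xx x y : [/\ wedge3 x x y = 0, wedge3 x y x = 0 & wedge3 y x x = 0].
Proof.
split.
- by apply: (altml_alt (wedge_altml M 3) (i := 0) (j := 1)); rewrite // !ffunE.
- by apply: (altml_alt (wedge_altml M 3) (i := 0) (j := 2)); rewrite // !ffunE.
- by apply: (altml_alt (wedge_altml M 3) (i := 1) (j := 2)); rewrite // !ffunE.
Qed.

(** A 3-cycle is two adjacent swaps; each swap changes the sign, by polarizing the alternating
    law. *)
Lemma wedge3_cycle x y z : wedge3 y z x = wedge3 x y z.
Proof.
have xx u v := wedge3_xx u v.
have swapl u v w : wedge3 v u w = - wedge3 u v w.
  have [] := xx (1 *: u + v) w; rewrite wedge3Pl !wedge3Pm !scale1r.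
  have [-> _ _] := xx u w; have [-> _ _] := xx v w.
  by rewrite add0r addr0 => /eqP; rewrite addrC addr_eq0 => /eqP.
have swapr u v w : wedge3 w v u = - wedge3 w u v.
  have [_ _] := xx (1 *: u + v) w; rewrite wedge3Pm !wedge3Pr !scale1r.
  have [_ _ ->] := xx u w; have [_ _ ->] := xx v w.
  by rewrite add0r addr0 => /eqP; rewrite addrC addr_eq0 => /eqP.
by rewrite swapr swapl opprK.
Qed.

Lemma wedge3_proj c d x y z : wedge3 (x - c *: z) (y - d *: z) z = wedge3 x y z.
Proof.
rewrite ![_ - _]addrC -!scaleNr wedge3Pl !wedge3Pm.
have [_ -> _] := wedge3_xx z y.
have [_ -> _] := wedge3_xx z z; have [_ _ ->] := wedge3_xx z x.
by rewrite !(scaler0, add0r).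
Qed.

(** The coefficients are the coordinates of the cross product [c × d]. *)
Lemma wedge2_expand c1 c2 c3 d1 d2 d3 x y z :
  wedge2 (c1 *: x + c2 *: y + c3 *: z) (d1 *: x + d2 *: y + d3 *: z) =
    (c2 * d3 - c3 * d2) *: wedge2 y z + (c3 * d1 - c1 * d3) *: wedge2 z x +
    (c1 * d2 - c2 * d1) *: wedge2 x y.
Proof.
have w0l u : wedge2 0 u = 0 :> extpow M 2.
  by have := wedge2Pl (-1) 0 0 u; rewrite scaler0 addr0 scaleN1r addNr.
have w0r u : wedge2 u 0 = 0 :> extpow M 2.
  by have := wedge2Pr (-1) u 0 0; rewrite scaler0 addr0 scaleN1r addNr.
rewrite -!addrA -[c3 *: z]addr0 -[d3 *: z]addr0 !wedge2Pl !wedge2Pr.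
rewrite !w0l !w0r !wedge2xx (wedge2C x y) (wedge2C y z) (wedge2C z x).
rewrite !scaler0 !addr0 !add0r !scalerDr !scalerN !scalerA !scalerBl.
by rewrite [LHS](AC (2*(2*2)) ((4*6)*((5*2)*(1*3)))).
Qed.

End Wedge3.

(** * From exterior squares to exterior cubes *)

Section Wedge3Last.
Variables (R : comPzRingType) (M N : lmodType R).

Lemma wedge_ffun2 (t : {ffun 'I_2 -> M}) : wedge t = wedge2 (t 0) (t 1).
Proof.
by congr wedge; apply/ffunP=> k; rewrite ffunE; have [->|->] := ord2_case k.
Qed.

Lemma wedge_last_wedge2 (h : {linear M -> N}) (v : N) (p q : M) :
  wedge_last h v (wedge2 p q) = wedge3 (h p) (h q) v.
Proof.
rewrite wedge_last_wedge; congr wedge; apply/ffunP; elim/ord3P; rewrite !ffunE.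
- have -> : 0 = lift ord_max 0 :> 'I_3 by apply: val_inj.
  by rewrite liftK ffunE.
- have -> : 1 = lift ord_max 1 :> 'I_3 by apply: val_inj.
  by rewrite liftK ffunE.
- have -> : 2 = ord_max :> 'I_3 by apply: val_inj.
  by rewrite unlift_none.
Qed.

End Wedge3Last.

(** * The determinant on R^3 *)

Section Det3.
Variable R : comPzRingType.
Local Notation R3 := ('cV[R]_2 * R^o)%type.

Definition crd (x : R3) (i : 'I_3) : R := [:: x.1 0 0; x.1 1 0; x.2]`_i.

(** Expanded along the last argument, as [(x × y).z], because [z] will be [s 1]. *)
Definition det3 (x y z : R3) : R :=
  crd z 0 * (crd x 1 * crd y 2 - crd x 2 * crd y 1) +
  crd z 1 * (crd x 2 * crd y 0 - crd x 0 * crd y 2) +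
  crd z 2 * (crd x 0 * crd y 1 - crd x 1 * crd y 0).

Lemma crdP c x y i : crd (c *: x + y) i = c * crd x i + crd y i.
Proof. by elim/ord3P: i; rewrite /crd /= ?mxE. Qed.

Lemma det3_altml :
  alternating_multilinear (fun t : {ffun 'I_3 -> R3} => det3 (t 0) (t 1) (t 2) : R^o).
Proof.
split=> [t i c x y|t i j].
  rewrite /GRing.scale /= -/(_ *: _).
  by elim/ord3P: i; rewrite !ffunE /= /det3 !crdP; ring.
by elim/ord3P: i; elim/ord3P: j => //= _; rewrite /det3 => ->; ring.
Qed.

End Det3.
(** Each total inverse in the symbol is evaluated by proving injectivity and exhibiting a
    preimage. *)
Lemma pinv_injK (T U : Type) (dflt : U -> T) (f : T -> U) :
  injective f -> cancel f ('pinv_dflt [set: T]%classic f).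
Proof. by move=> f_inj x; apply: pinvKV => [y z _ _ /f_inj|]; rewrite ?inE. Qed.

Lemma linear_regular (R : comPzRingType) (M : lmodType R)
    (s : {linear R^o -> M}) (c : R) : s c = c *: s 1.
Proof. by rewrite -linearZ; congr (s _); symmetry; apply: mulr1. Qed.

(** * The determinant of the kernel of a, and the forms of the symbol *)

Section KernelDet.
Variable R : comPzRingType.
Local Notation R3 := (('cV[R]_2 * R^o)%type : lmodType R).
Variables (a : {linear R3 -> R^o}) (s : {linear R^o -> R3}) (sK : cancel s a).

Let e (i : 'I_3) : R3 := (\col_(j < 2) (val j == val i)%:R, (i == 2)%:R).

Lemma crd_sum (x : R3) : x = crd x 0 *: e 0 + crd x 1 *: e 1 + crd x 2 *: e 2.
Proof.
case: x => u c; rewrite /e /crd /=; congr pair => /=.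
  apply/matrixP=> i j; rewrite [j]ord1 !mxE.
  by have [->|->] := ord2_case i; rewrite /= ?mulr1 ?mulr0 ?addr0 ?add0r.
by rewrite !scaler0 !add0r; symmetry; apply: mulr1.
Qed.

Lemma linear_crd (V : lmodType R) (f : {linear R3 -> V}) x :
  f x = crd x 0 *: f (e 0) + crd x 1 *: f (e 1) + crd x 2 *: f (e 2).
Proof. by rewrite {1}[x]crd_sum !linearD !linearZ. Qed.

Definition det3_ext (w : extpow R3 3) : R^o :=
  ext_lift (fun t : {ffun 'I_3 -> R3} => det3 (t 0) (t 1) (t 2) : R^o) w.

HB.instance Definition _ := GRing.isLinear.Build R (extpow R3 3) R^o _
  det3_ext (ext_lift_linear (det3_altml R)).

Lemma det3_wedge3 x y z : det3_ext (wedge3 x y z) = det3 x y z.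
Proof. by rewrite /det3_ext ext_lift_wedge ?ffunE //; apply: det3_altml. Qed.

Let p i : kernel a := ker_proj sK (e i).
Let vol : extpow R3 3 := wedge3 (e 0) (e 1) (e 2).

(** The contraction of [e_1 /\ e_2 /\ e_3] by [a], projected to the kernel. It generates the
    determinant of the kernel, which itself may fail to be free. *)
Definition ker_vol : extpow (kernel a) 2 :=
  (a (e 0) : R) *: wedge2 (p 1) (p 2) + (a (e 1) : R) *: wedge2 (p 2) (p 0) +
  (a (e 2) : R) *: wedge2 (p 0) (p 1).

Fact ker_proj_linear : linear (ker_proj sK).
Proof.
move=> c x y; apply: val_inj => /=.
by rewrite (linearP a) (linearP s) scalerBr opprD addrACA.
Qed.
HB.instance Definition _ :=
  GRing.isLinear.Build R R3 (kernel a) _ (ker_proj sK) ker_proj_linear.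

Lemma sum_a_s : (a (e 0) : R) * crd (s 1) 0 + (a (e 1) : R) * crd (s 1) 1 +
                (a (e 2) : R) * crd (s 1) 2 = 1.
Proof.
rewrite -[RHS](sK 1) [RHS]linear_crd ![_ * crd _ _]mulrC.
by [].
Qed.

Lemma ker_crd (x : kernel a) :
  (a (e 0) : R) * crd (val x) 0 + (a (e 1) : R) * crd (val x) 1 +
  (a (e 2) : R) * crd (val x) 2 = 0.
Proof.
have /eqP : a (val x) == 0 by case: x.
by rewrite linear_crd ![_ * crd _ _]mulrC.
Qed.

(** The projection fixes the kernel, so the [p i] generate it. *)
Lemma ker_sum (x : kernel a) :
  x = crd (val x) 0 *: p 0 + crd (val x) 1 *: p 1 + crd (val x) 2 *: p 2.
Proof.
rewrite -linear_crd; apply: val_inj => /=.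
have /eqP -> : a (val x) == 0 by case: x.
by rewrite linear0 subr0.
Qed.

(** Modulo [s 1] each [p i] is [e i], so wedging with [s 1] allows [e i] in its place. Expanding
    [s 1] then leaves [vol] with coefficient [a (s 1) = 1]. *)
Lemma det_s_ker_vol : det_s s ker_vol = vol.
Proof.
have E i j : wedge_last (val : {linear kernel a -> R3}) (s 1)
    (wedge2 (p i) (p j)) = wedge3 (e i) (e j) (s 1).
  rewrite wedge_last_wedge2 /= (linear_regular s (a (e i))) (linear_regular s (a (e j))).
  exact: wedge3_proj.
rewrite /det_s !linearD !linearZ /= !E.
have w0 x y : wedge3 x y 0 = 0 :> extpow R3 3.
  by have := wedge3Pr (-1) 0 0 x y; rewrite scaler0 addr0 scaleN1r addNr.
have W x y : wedge3 x y (s 1) = crd (s 1) 0 *: wedge3 x y (e 0) +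
    crd (s 1) 1 *: wedge3 x y (e 1) + crd (s 1) 2 *: wedge3 x y (e 2).
  rewrite [in LHS](crd_sum (s 1)) -[in LHS]addrA -[crd _ 2 *: e 2]addr0 !wedge3Pr w0.
  by rewrite addr0 addrA.
have xx := @wedge3_xx R R3; rewrite !W.
have [_ -> _] := xx (e 1) (e 2); have [_ _ ->] := xx (e 2) (e 1).
have [_ -> _] := xx (e 2) (e 0); have [_ _ ->] := xx (e 0) (e 2).
have [_ -> _] := xx (e 0) (e 1); have [_ _ ->] := xx (e 1) (e 0).
rewrite !scaler0 !addr0 !add0r (wedge3_cycle (e 0)) -(wedge3_cycle (e 2)).
by rewrite -/vol !scalerA -!scalerDl sum_a_s scale1r.
Qed.

Lemma wedge2_ker (x y : kernel a) :
  wedge2 x y = det3 (val x) (val y) (s 1) *: ker_vol.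
Proof.
(* With [D = det (x, y, s 1)], this is [x \times y = D *: a] for [x, y] in [ker a]. *)
have cross (s1 s2 s3 a1 a2 a3 p1 p2 p3 q1 q2 q3 : R) :
    a1 * s1 + a2 * s2 + a3 * s3 = 1 -> a1 * p1 + a2 * p2 + a3 * p3 = 0 ->
    a1 * q1 + a2 * q2 + a3 * q3 = 0 ->
    p2 * q3 - p3 * q2 = (s1 * (p2 * q3 - p3 * q2) +
       s2 * (p3 * q1 - p1 * q3) + s3 * (p1 * q2 - p2 * q1)) * a1.
  move=> as1 ap aq.
  (* First coordinate of [det(p, q, s) a = (a.s) (p × q) + (a.p) (q × s) + (a.q) (s × p)], valid for
     any four vectors. *)
  transitivity ((p2 * q3 - p3 * q2) * (a1 * s1 + a2 * s2 + a3 * s3)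
    - (s2 * q3 - s3 * q2) * (a1 * p1 + a2 * p2 + a3 * p3)
    + (s2 * p3 - s3 * p2) * (a1 * q1 + a2 * q2 + a3 * q3)); last by ring.
  by rewrite as1 ap aq mulr1 !mulr0 subr0 addr0.
(* The other two coordinates follow from [cross] by cyclic relabelling. *)
have rot (u v w c : R) : u + v + w = c -> v + w + u = c.
  by move=> <-; rewrite addrC addrA.
rewrite {1}[x]ker_sum {1}[y]ker_sum wedge2_expand /ker_vol !scalerDr !scalerA.
have := sum_a_s; have := ker_crd x; have := ker_crd y.
move=> ay ax as1; rewrite /det3; congr (_ *: _ + _ *: _ + _ *: _).
- exact: cross as1 ax ay.
- apply: etrans (cross _ _ _ _ _ _ _ _ _ _ _ _ (rot _ _ _ _ as1)
    (rot _ _ _ _ ax) (rot _ _ _ _ ay)) _.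
  by congr (_ * _); rewrite addrC addrA.
- apply: etrans (cross _ _ _ _ _ _ _ _ _ _ _ _ (rot _ _ _ _ (rot _ _ _ _ as1))
    (rot _ _ _ _ (rot _ _ _ _ ax)) (rot _ _ _ _ (rot _ _ _ _ ay))) _.
  by congr (_ * _); rewrite -addrA addrC.
Qed.

Lemma det3_vol : det3_ext vol = 1.
Proof. by rewrite det3_wedge3 /det3 /e /crd /= !mxE /=; ring. Qed.

(** Provides a left inverse of [det_s]. It suffices to check a wedge [x /\ y], where [wedge2_ker]
    applies. *)
Lemma ker_ext2E (w : extpow (kernel a) 2) :
  w = (det3_ext (det_s s w) : R) *: ker_vol.
Proof.
elim/ext_wedge_ind: w => [|c t x ih]; first by rewrite /det_s !linear0 scale0r.
rewrite {1}ih /det_s !linearP scalerDl -scalerA; congr (_ *: _ + _).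
rewrite /= wedge_ffun2 wedge_last_wedge2.
by rewrite det3_wedge3 -wedge2_ker.
Qed.

Lemma det_s_inj : injective (det_s (a := a) s).
Proof. by move=> w w' ww'; rewrite [w]ker_ext2E ww' -ker_ext2E. Qed.

Lemma det_sZ c w : det_s (a := a) s (c *: w) = c *: det_s s w.
Proof. by rewrite /det_s linearZ. Qed.

Let vt := opp_triv (theta0 R).

(** Both [- r *: ker_vol] under [det_s] and [vt r] under [det_e] give [- r *: vol]; the sign is that
    of [- theta_0]. *)
Lemma theta_aE (r : R) : theta_a vt a s r = - r *: ker_vol.
Proof.
rewrite /theta_a; suff -> : det_e (vt r) = det_s s (- r *: ker_vol).
  exact: (pinv_injK _ det_s_inj).
rewrite det_sZ det_s_ker_vol /det_e.
have -> : vt r = - r *: wedge2 (std R 0) (std R 1) by rewrite scaleNr.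
rewrite linearZ /= wedge_last_wedge2; congr (_ *: wedge3 _ _ _);
  rewrite /e /= /inl0; congr pair; apply/matrixP=> i j; rewrite [j]ord1 !mxE ?andbT.
- by [].
- by [].
- by have [->|->] := ord2_case i.
Qed.

Lemma theta_a_inj : injective (theta_a vt a s).
Proof.
move=> r r'; rewrite !theta_aE => /(congr1 (det3_ext \o det_s s)) /=.
rewrite !det_sZ det_s_ker_vol !linearZ /=.
rewrite det3_vol => /eqP; rewrite /GRing.scale /= !mulr1 eqr_opp => /eqP.
exact.
Qed.

Lemma chi_aE (x y : kernel a) : chi_a vt s x y = - det3 (val x) (val y) (s 1).
Proof.
rewrite /chi_a wedge2_ker; set d := det3 _ _ _.
by rewrite -[d]opprK -theta_aE (pinv_injK _ theta_a_inj) opprK.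
Qed.

Lemma chi0E (x y : 'cV[R]_2) : chi0 vt x y = - (x 0 0 * y 1 0 - x 1 0 * y 0 0).
Proof.
rewrite /chi0 wedge2_std; set d := _ - _.
have -> : d *: wedge2 (std R 0) (std R 1) = vt (- d).
  by rewrite /= /opp_triv_fun /= /theta0_fun scaleNr opprK.
by apply: pinv_injK; apply: bij_inj (triv_bij vt).
Qed.

Lemma det3_proj (c d : R) (x y z : R3) :
  det3 (x - c *: z) (y - d *: z) z = det3 x y z.
Proof. by rewrite ![_ - _]addrC -!scaleNr /det3 !crdP; ring. Qed.

(** The projection subtracts multiples of [s 1], which the determinant with last argument [s 1]
    ignores. *)
Lemma gen_vaserstein_form1 (x y : 'cV[R]_2 * 'cV[R]_2) :
  pullback (i_plus_1 sK) (perp (chi_a vt s) (mxform (psi2 R))) x y =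
    - det3 (x.1, x.2 0 0) (y.1, y.2 0 0) (s 1) +
    (a (x.1, x.2 0 0) * y.2 1 0 - x.2 1 0 * a (y.1, y.2 0 0)).
Proof.
rewrite /pullback /perp /= mxform_psi2 !mxE /= chi_aE /=; congr (- _ + _).
by rewrite (linear_regular s (a (x.1, _))) (linear_regular s (a (y.1, _))) det3_proj.
Qed.

End KernelDet.

(** * Identification of R^2 + R^2 with R^4 *)

Section ChangeOfCoordinates.
Variable R : comPzRingType.

(** The second coordinate of the added [R^2] comes first, since index 0 of [V(a, b)] is the one
    paired with the row [a]; the other three are those of [P_0 + R]. *)
Definition coord4 (x : 'cV[R]_2 * 'cV[R]_2) : 'cV[R]_4 :=
  \col_i [:: x.2 1 0; x.1 0 0; x.1 1 0; x.2 0 0]`_i.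

Fact coord4_linear : linear coord4.
Proof.
by move=> c x y; apply/matrixP=> i j; rewrite !mxE; elim/ord4P: i; rewrite /= ?mxE.
Qed.
HB.instance Definition _ := GRing.isLinear.Build R ('cV[R]_2 * 'cV[R]_2)%type
  'cV[R]_4 _ coord4 coord4_linear.

Lemma coord4_bij : bijective coord4.
Proof.
exists (fun v : 'cV[R]_4 => (\col_i [:: v 1 0; v 2 0]`_i,
  \col_i [:: v 3 0; v 0 0]`_i)).
  move=> [x y]; congr pair; apply/matrixP=> i j; rewrite [j]ord1 !mxE;
    by have [->|->] := ord2_case i; rewrite /= ?mxE.
move=> v; apply/matrixP=> i j; rewrite [j]ord1 {j} !mxE; move: i.
by elim/ord4P; rewrite /= ?mxE.
Qed.

Definition row_of_pair (x : 'cV[R]_2 * R^o) : 'rV[R]_3 := \row_i crd x i.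

Lemma row_mapE (a : 'rV[R]_3) x : row_map a x = \sum_i a 0 i * row_of_pair x 0 i.
Proof.
rewrite /row_map [LHS]mxE; apply: eq_bigr => i _; congr (_ * _).
rewrite [RHS]mxE.
rewrite /crd; elim/ord3P: i => /=.
- rewrite -(col_mxEu x.1 ((x.2 : R)%:M : 'M_1)).
  by congr (col_mx _ _ _ _); apply: val_inj.
- rewrite -(col_mxEu x.1 ((x.2 : R)%:M : 'M_1)).
  by congr (col_mx _ _ _ _); apply: val_inj.
- have E : x.2 = ((x.2 : R)%:M : 'M_1) 0 0 by rewrite mxE.
  rewrite [RHS]E -[RHS](col_mxEd x.1).
  by congr (col_mx _ _ _ _); apply: val_inj.
Qed.

Lemma pullback_psi4_coord4 (x y : 'cV[R]_2 * 'cV[R]_2) :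
  perp (chi0 (opp_triv (theta0 R))) (mxform (psi2 R)) x y =
  pullback coord4 (pullback (mulmx (perm_mx [~ tperm 0%R 1%R, tperm 0%R 3%R : 'S_4]%g))
    (mxform (psi4 R))) x y.
Proof.
by rewrite [RHS]mxform_psi4_cyc /perp chi0E mxform_psi2 !mxE /=; ring.
Qed.

(** The choice of [- theta_0] matters here: the term [- det(x', y', s 1)] is the term
    [- b.(x' × y')] of [V(a, b)] at [b = s 1]. *)
Lemma pullback_vaserstein_coord4 (a : 'rV[R]_3)
    (s : {linear R^o -> ('cV[R]_2 * R^o)%type}) (sK : cancel s (row_map a))
    (x y : 'cV[R]_2 * 'cV[R]_2) :
  pullback (i_plus_1 sK)
    (perp (chi_a (opp_triv (theta0 R)) s) (mxform (psi2 R))) x y =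
  pullback coord4 (mxform (vaserstein_mx a (row_of_pair (s 1)))) x y.
Proof.
rewrite gen_vaserstein_form1 /pullback mxform_vaserstein /= !row_mapE !sum_ord3.
rewrite /det3 !mxE /crd /=; ring.
Qed.

End ChangeOfCoordinates.

(** * Comparison of the generalized and the usual symbol *)

Theorem mainTheorem6 (R : comPzRingType) (a b : 'rV[R]_3)
    (ab1 : \sum_i a 0 i * b 0 i = 1)
    (s : {linear R^o -> ('cV[R]_2 * R^o)%type}) (sK : cancel s (row_map a)) :
  exists (hV : is_triple (gen_vaserstein (opp_triv (theta0 R)) sK))
         (hM : is_triple (mx_pretriple (psi4 R) (vaserstein_mx a b))),
    Vclass hV = Vclass hM.
Proof.
have as1 : \sum_i a 0 i * row_of_pair (s 1) 0 i = 1 by rewrite -row_mapE sK.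
have hcyc := psi4_cyc_alt_iso R; have h4 := psi4_alt_iso R.
have has := vaserstein_alt_iso as1; have hab := vaserstein_alt_iso ab1.
have hV : is_triple (gen_vaserstein (opp_triv (theta0 R)) sK).
  split=> /=; first by apply: fg_projective_prod; apply: fg_projective_cV.
    rewrite (funext (fun x => funext (pullback_psi4_coord4 x))).
    exact: alt_iso_pullback (coord4_bij R) hcyc.
  rewrite (funext (fun x => funext (pullback_vaserstein_coord4 sK x))).
  exact: alt_iso_pullback (coord4_bij R) has.
pose hP := fg_projective_cV R 4.
exists hV, (IsTriple (T := mx_pretriple _ _) hP h4 hab); apply/VpiP.
apply: (@Veq_trans _ _ [:: (true, mk_triple hP hcyc has)]).
  apply: Veq_isometric; exists (@coord4 R : {linear _ -> _}).
  split; [exact: coord4_bij|exact: pullback_psi4_coord4|].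
  exact: pullback_vaserstein_coord4.
have c_cyc := Veq_psi4 h4 hcyc; have c_ab := Veq_vaserstein has hab ab1 as1.
(* With [c] the permuted [psi4]: [[c, V(a, s 1)] = [psi4, c] + [c, V(a, s 1)] = [psi4, V(a, s 1)]],
   and adding the zero class [[V(a, s 1), V(a, b)]] gives [[psi4, V(a, b)]]. *)
apply: Veq_trans (Veq_cat (Veq_sym c_cyc) (Veq_refl [:: _])) _.
apply: Veq_trans (Veq_comp hP h4 hcyc has) _.
apply: Veq_trans (Veq_comp hP h4 has hab).
exact: Veq_cat (Veq_refl [:: _]) (Veq_sym c_ab).
Qed.
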